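(* Let $\gamma$ be a nonconvex standard polygonal escape minimizer with selected gap $FT$, upward contact $M$, and marked contacts as described in the context. Assume both near anchors genuinely fail: $$Z_2\prec F\prec M\prec T\prec Z_1.$$ Let the right and left delimiter gaps $UV$ and $WX$ satisfy $$F\prec U\prec T\prec V,\qquad W\prec F\prec X\prec T.$$ Then for every independent pair $(t_R,t_L)\in[-t_*,t_*]^2$ of delimiter parameters and every compatible weak deque order of all marked contacts, $$\operatorname{len}(\gamma)\ge R>D,\qquad R=\frac{96717}{100000},\quad D=\frac{82074390584}{84861020075}.$$
   Context: Put $p=766$, $q=197$, $S=p^2+q^2=625565$, $s=p/\sqrt S$, $c=q/\sqrt S$, $\beta=\arctan(p/q)$, $\eta=\frac\pi2-\beta$, $\rho=2sc=\frac{301804}{625565}$, $\kappa=s^2-c^2=\frac{547947}{625565}$, $\chi=2c^2=\frac{77618}{625565}$, $t_*=\tan\frac\eta2$, $u_\phi=(\cos\phi,\sin\phi)$. Let $\mathcal K=\operatorname{conv}\{(-c,0),(c,0),(0,s)\}$. A path is an escape path if no translated and rotated copy of it lies in the interior of $\mathcal K$. A polygonal path is standard if it is simple and its nonrepeated vertices are exactly the extreme vertices of its convex hull, each visited once; a hull edge not traversed by the path is a gap; a standard path is convex if its links follow one hull-boundary chain between its endpoints, nonconvex otherwise. $X\prec Y$ means $X$ is visited strictly before $Y$. Setting: $\gamma$ is a nonconvex standard polygonal escape path, length-minimal among polygonal escape paths with at most $N$ segments for some $N$. Its selected gap is a gap $FT$ with a hull vertex $M$ and $h>0$ such that, in suitable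 rigid coordinates, the hull $H=\operatorname{conv}\gamma$ lies in $0\le y\le h$ (both lines supporting it), $F=(x_F,0)$, $T=(x_T,0)$, $M=(x_M,h)$, $x_F\le x_T$, $F\prec M\prec T$, and $\operatorname{len}(\gamma)\ge(1+\sqrt2)h$. A right delimiter gap is a gap $UV$ with $U,V$ adjacent hull vertices, $U$ before $V$ on the clockwise boundary arc of $H$ from $M$ to $Z_1$; its outward unit normal is $n_R=u_{\beta+\theta_R}$ with $-\eta\le\theta_R\le\eta$, and $t_R:=\tan(\theta_R/2)$. A left delimiter gap is a gap $WX$ with $W,X$ adjacent hull vertices, $W$ before $X$ on the clockwise boundary arc from $Z_2$ to $M$; its outward unit normal is $N_L=u_{\pi-\beta-\theta_L}$ with $-\eta\le\theta_L\le\eta$, and $t_L:=\tan(\theta_L/2)$. Marked contacts: a contact of a direction $v$ is a vertex of $H$ maximizing $x\cdot v$ over $H$, and the label of a direction also denotes its chosen contact. With $C_\bullet=\frac{1-t_\bullet^2}{1+t_\bullet^2}$, $S_\bullet=\frac{2t_\bullet}{1+t_\bullet^2}$ for $\bullet\in\{R,L\}$, the directions are: $Z_1=(\rho,\kappa)$, $Z_2=(-\rho,\kappa)$, $P_2=2c(s,c)$, $Q_3=2c(-s,c)$, $E_1=(\rho,-\chi)$, $E_2=(-\rho,-\kappa)$, $E_3=(-\rho,-\chi)$, $E_4=(\rho,-\kappa)$, $(0,1)$ with contact $M$, $(0,-1)$ with contacts $F,T$, $n_R$ with contacts $U,V$, $N_L$ with contacts $W,X$, $A_R=\frac{1}{\sqrt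 S}(-2qC_R,-2qS_R)$, $B_R=\frac1{\sqrt S}(qC_R+pS_R,\,qS_R-pC_R)$, $A_L=\frac1{\sqrt S}(2qC_L,-2qS_L)$, $B_L=\frac1{\sqrt S}(-qC_L-pS_L,\,-pC_L+qS_L)$. The contacts are chosen weakly monotone along the clockwise boundary from $F$ to $T$ in the fan order $$F,B_L,E_2,E_3,A_R,Q_3,Z_2,W,X,M,U,V,Z_1,P_2,A_L,E_1,E_4,B_R,T.$$ A compatible weak deque order is a temporal order of these labels along $\gamma$ (labels at the same vertex may be tied, and ties may be resolved in either order) that satisfies the stated incidences and in which, at every stage, the not-yet-visited labels form an interval in the cyclic fan order. ''Genuinely fail'' means that $Z_2\prec F$ and $T\prec Z_1$ hold at distinct vertices. *)

(* Defs.v *)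
From HB Require Import structures.
From mathcomp Require Import all_boot all_order all_algebra.
From mathcomp Require Import all_classical all_reals all_analysis.
Set Implicit Arguments.
Unset Strict Implicit.
Unset Printing Implicit Defensive.
Import Order.TTheory GRing.Theory Num.Theory numFieldNormedType.Exports.
Local Open Scope classical_set_scope.
Local Open Scope ring_scope.

(* The marked contacts, in the clockwise fan order. *)
Inductive label :=
  LF | LBL | LE2 | LE3 | LAR | LQ3 | LZ2 | LW | LX | LM
| LU | LV | LZ1 | LP2 | LAL | LE1 | LE4 | LBR | LT.

Definition fan : seq label :=
  [:: LF; LBL; LE2; LE3; LAR; LQ3; LZ2; LW; LX; LM;
      LU; LV; LZ1; LP2; LAL; LE1; LE4; LBR; LT].

Definition label_code (l : label) : nat :=
  match l with
  | LF => 0 | LBL => 1 | LE2 => 2 | LE3 => 3 | LAR => 4 | LQ3 => 5 | LZ2 => 6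
  | LW => 7 | LX => 8 | LM => 9 | LU => 10 | LV => 11 | LZ1 => 12 | LP2 => 13
  | LAL => 14 | LE1 => 15 | LE4 => 16 | LBR => 17 | LT => 18
  end%N.

Lemma label_codeK : pcancel label_code (onth fan).
Proof. by case. Qed.

HB.instance Definition _ := Countable.copy label (pcan_type label_codeK).

Section PlaneGeometry.
Context {R : realType}.

(* Points are pairs of reals. The norm that the library puts on R * R is the
   sup norm, so Euclidean length is defined separately; the product topology
   is the Euclidean one. A polygonal path is the list of its vertices, in the
   order in which they are visited. *)
Local Notation plane := (R * R)%type.

Definition dot (x v : plane) : R := x.1 * v.1 + x.2 * v.2.

Definition edist (x y : plane) : R :=
  Num.sqrt ((x.1 - y.1) ^+ 2 + (x.2 - y.2) ^+ 2).

Definition plength (g : seq plane) : R :=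
  \sum_(i < (size g).-1) edist (nth 0 g i) (nth 0 g i.+1).

Definition segment (a b : plane) : set plane :=
  [set (1 - t) *: a + t *: b | t in `[0, 1]].

Definition path_set (g : seq plane) : set plane :=
  [set x | x \in g] `|`
  [set x | exists a b, infix [:: a; b] g /\ segment a b x].

Definition hull (A : set plane) : set plane :=
  smallest (fun C : set plane => convex_set C) A.

Definition extreme_point (A : set plane) (x : plane) : Prop :=
  A x /\ forall y z (t : R), A y -> A z -> 0 < t -> t < 1 ->
    x = (1 - t) *: y + t *: z -> y = x /\ z = x.

Definition contact (H : set plane) (v x : plane) : Prop :=
  extreme_point H x /\ forall y, H y -> dot y v <= dot x v.

(* Two vertices are adjacent on the boundary of H when they are distinct and
   lie on a common supporting line, v being normal to that line. *)
Definition hull_edge (H : set plane) (a b : plane) : Prop :=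
  a != b /\ exists v, v != 0 /\ contact H v a /\ contact H v b.

Definition rigid_move (a : plane) (th : R) (x : plane) : plane :=
  (a.1 + (cos th * x.1 - sin th * x.2), a.2 + (sin th * x.1 + cos th * x.2)).

Definition rigid_coordinates (f : plane -> plane) : Prop :=
  exists a th, f =1 rigid_move a th \/
               f =1 (fun x => rigid_move a th (x.1, - x.2)).

Definition par_p : R := 766.
Definition par_q : R := 197.
Definition par_S : R := par_p ^+ 2 + par_q ^+ 2.
Definition par_s : R := par_p / Num.sqrt par_S.
Definition par_c : R := par_q / Num.sqrt par_S.
Definition beta : R := atan (par_p / par_q).
Definition eta : R := pi / 2 - beta.
Definition rho : R := 2 * par_s * par_c.
Definition kappa : R := par_s ^+ 2 - par_c ^+ 2.
Definition chi : R := 2 * par_c ^+ 2.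
Definition tstar : R := tan (eta / 2).
Definition unit_vec (phi : R) : plane := (cos phi, sin phi).

Definition triangle : set plane :=
  hull [set x | x \in [:: (- par_c, 0); (par_c, 0); (0, par_s)]].

Definition escape (g : seq plane) : Prop :=
  forall a th, ~ (rigid_move a th @` path_set g `<=` interior triangle).

Definition simple (g : seq plane) : Prop :=
  uniq g /\
  forall i j x, (i < j)%N -> (j.+1 < size g)%N ->
    segment (nth 0 g i) (nth 0 g i.+1) x ->
    segment (nth 0 g j) (nth 0 g j.+1) x ->
    j = i.+1 /\ x = nth 0 g j.

Definition standard (g : seq plane) : Prop :=
  simple g /\
  forall x, x \in g <-> extreme_point (hull (path_set g)) x.

Definition orient (a b c : plane) : R :=
  (b.1 - a.1) * (c.2 - a.2) - (b.2 - a.2) * (c.1 - a.1).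

(* w lists the vertices of a convex polygon in clockwise order, starting
   anywhere. *)
Definition clockwise (w : seq plane) : Prop :=
  forall i j k, (i < j)%N -> (j < k)%N -> (k < size w)%N ->
    orient (nth 0 w i) (nth 0 w j) (nth 0 w k) < 0.

(* For a standard path, whose vertices are all the hull vertices: the links
   follow the hull boundary from one endpoint to the other. *)
Definition convex_path (g : seq plane) : Prop :=
  clockwise g \/ clockwise (rev g).

Definition gap (g : seq plane) (a b : plane) : Prop :=
  hull_edge (hull (path_set g)) a b /\
  ~~ infix [:: a; b] g /\ ~~ infix [:: b; a] g.

(* A path with at most N segments has at most N.+1 vertices. *)
Definition escape_minimizer (g : seq plane) : Prop :=
  exists N : nat, [/\ escape g, (size g <= N.+1)%N &
    forall g' : seq plane, escape g' -> (size g' <= N.+1)%N ->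
      plength g <= plength g'].

Definition before (g : seq plane) (x y : plane) : Prop :=
  (index x g < index y g)%N.

Definition selected_gap (g : seq plane) (F M T : plane) (h : R) : Prop :=
  [/\ gap g F T, extreme_point (hull (path_set g)) M, 0 < h &
      forall x, hull (path_set g) x -> 0 <= x.2 <= h] /\
  [/\ F.2 = 0, T.2 = 0, M.2 = h & F.1 <= T.1] /\
  [/\ before g F M, before g M T & (1 + Num.sqrt 2) * h <= plength g].

Definition direction (thR thL tR tL : R) (l : label) : plane :=
  let C t := (1 - t ^+ 2) / (1 + t ^+ 2) in
  let S t := 2 * t / (1 + t ^+ 2) in
  let p := par_p in let q := par_q in
  let r := (Num.sqrt par_S)^-1 in
  match l with
  | LF | LT => (0, -1)
  | LM => (0, 1)
  | LZ1 => (rho, kappa)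
  | LZ2 => (- rho, kappa)
  | LP2 => (2 * par_c) *: ((par_s, par_c) : plane)
  | LQ3 => (2 * par_c) *: ((- par_s, par_c) : plane)
  | LE1 => (rho, - chi)
  | LE2 => (- rho, - kappa)
  | LE3 => (- rho, - chi)
  | LE4 => (rho, - kappa)
  | LU | LV => unit_vec (beta + thR)
  | LW | LX => unit_vec (pi - beta - thL)
  | LAR => r *: ((- 2 * q * C tR, - 2 * q * S tR) : plane)
  | LBR => r *: ((q * C tR + p * S tR, q * S tR - p * C tR) : plane)
  | LAL => r *: ((2 * q * C tL, - 2 * q * S tL) : plane)
  | LBL => r *: ((- q * C tL - p * S tL, - p * C tL + q * S tL) : plane)
  end.

(* w lists all hull vertices of g clockwise, from F to T. *)
Definition boundary_listing (g : seq plane) (F T : plane) (w : seq plane) :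
    Prop :=
  [/\ uniq w, forall x, x \in w <-> extreme_point (hull (path_set g)) x,
      clockwise w, index F w = 0%N & index T w = (size w).-1].

Definition marked_contacts (g w : seq plane) (thR thL tR tL : R)
    (ct : label -> plane) : Prop :=
  [/\ boundary_listing g (ct LF) (ct LT) w,
      forall l, contact (hull (path_set g)) (direction thR thL tR tL l) (ct l) &
      sorted leq [seq index (ct l) w | l <- fan]].

(* UV is an untraversed hull edge with outward unit normal n; U precedes V on
   the boundary arc A .. B, positions being read in the clockwise listing w. *)
Definition delimiter_gap (g w : seq plane) (n A U V B : plane) : Prop :=
  [/\ gap g U V, contact (hull (path_set g)) n U &
      contact (hull (path_set g)) n V] /\
  [/\ (index A w <= index U w)%N, (index U w < index V w)%N &
      (index V w <= index B w)%N].

Definition right_delimiter_gap (g w : seq plane) (thR tR : R)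
    (ct : label -> plane) : Prop :=
  [/\ delimiter_gap g w (unit_vec (beta + thR))
        (ct LM) (ct LU) (ct LV) (ct LZ1),
      - eta <= thR <= eta & tR = tan (thR / 2)].

Definition left_delimiter_gap (g w : seq plane) (thL tL : R)
    (ct : label -> plane) : Prop :=
  [/\ delimiter_gap g w (unit_vec (pi - beta - thL))
        (ct LZ2) (ct LW) (ct LX) (ct LM),
      - eta <= thL <= eta & tL = tan (thL / 2)].

End PlaneGeometry.

Definition cyclic_interval (s : seq label) : Prop :=
  exists i n, s =i take n (rot i fan).

(* ord is a total order of the labels refining the weak order in which g
   visits their contacts, so that ties are resolved in ord; drop k ord is the
   set of labels not yet visited at stage k. *)
Definition compatible_deque_order (R : realType) (g : seq (R * R))
    (ct : label -> R * R) (ord : seq label) : Prop :=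
  [/\ perm_eq ord fan,
      sorted (fun l l' => index (ct l) g <= index (ct l') g)%N ord &
      forall k, cyclic_interval (drop k ord)].

(* The constants are written in groups of three digits because numerals denote
   unary naturals: R_const = 96717 / 100000 and
   D_const = 82074390584 / 84861020075. *)
Definition R_const {R : realType} : R := (96 * 10 ^+ 3 + 717) / 10 ^+ 5.
Definition D_const {R : realType} : R :=
  (82 * 10 ^+ 9 + 74 * 10 ^+ 6 + 390 * 10 ^+ 3 + 584) /
  (84 * 10 ^+ 9 + 861 * 10 ^+ 6 + 20 * 10 ^+ 3 + 75).

(* Main.v *)
Require Import Defs.
From mathcomp Require Import all_boot all_order all_algebra.
From mathcomp Require Import all_classical all_reals all_analysis.
From mathcomp Require Import ring lra.
Import Order.TTheory GRing.Theory Num.Theory numFieldNormedType.Exports.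
Local Open Scope ring_scope.

Set Implicit Arguments.
Unset Strict Implicit.
Unset Printing Implicit Defensive.

(** The proof is a duality argument that treats all deque orders at once.

    Upper side. Give every label [l] a weight [w l] and consider the sum of
    [w l * dot (ct l) (d l)], where [d l] is the direction of [l]. If the
    weighted directions add up to zero, Abel summation along the path rewrites
    this sum as the sum, over the links, of the dot product of the link with
    the resultant of the weighted directions of the labels that are still to be
    visited. If all these resultants lie in the unit disk, each term is at most
    the length of its link, so the weighted sum is at most the length of the
    path ([weighted_contacts_le_plength]).

    Lower side. The directions fall into four triples, (F, Z1, Q3),
    (T, Z2, P2), (U or V, A_R, B_R) and (W or X, A_L, B_L), each consisting of
    the outward normals of a rotated copy of the triangle, scaled by the lengths
    of its sides. Such a triple adds up to zero, and its three support values
    add up to at least [rho], because otherwise a copy of the path would fit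
    inside the triangle ([escape_support]). Weights that are constant on the
    triples, 153/400 on the first two and 31/50 on the others, therefore give a
    weighted sum of at least 2 (153/400 + 31/50) [rho], which exceeds
    [R_const] ([support_total]).

    The resultants. U and V have equal support values, so the weight of their
    normal may be divided between them at will, and likewise for W and X; the
    division, affine in the sines of the two delimiter angles, is what makes the
    resultants fit in the disk. The visited labels grow like a deque, and the
    order of F, T and the delimiters confines the unvisited set to three shapes:
    a fan interval of the labels strictly between U and T once T is visited; the
    fan interval from X, M, U or V to T between the visits of F and T; and,
    before that, the complement of a fan interval strictly between F and X
    ([suffix_shape]). Only finitely many resultants remain, whatever the order.
    A reflection exchanges left and right, most of the resultants are short by
    the triangle inequality, and six polynomial inequalities on the square of
    delimiter angles settle the rest ([suffix_disk]). *)

(** * Convex hulls, rigid motions and the triangle *)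

Section Geometry.
Local Open Scope classical_set_scope.
Context {R : realType}.
Local Notation plane := (R * R)%type.
Implicit Types (x y z : plane) (g : seq plane) (A C : set plane).

Lemma plane_combE (t : R) x y :
  (1 - t) *: x + t *: y = ((1 - t) * x.1 + t * y.1, (1 - t) * x.2 + t * y.2).
Proof. by []. Qed.

Lemma convex_setP C :
  convex_set C <->
  forall x y (t : R), 0 <= t <= 1 -> C x -> C y -> C ((1 - t) *: x + t *: y).
Proof.
split=> [C_convex x y t t01 Cx Cy|C_closed x y l /set_mem Cx /set_mem Cy].
  have := C_convex y x (Itv01 (proj1 (andP t01)) (proj2 (andP t01))).
  by rewrite !inE => /(_ Cy Cx); rewrite /conv /= addrC.
rewrite inE /conv /= addrC; apply: C_closed => //.
by apply/andP; split.
Qed.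

Lemma hull_sub A C : convex_set C -> A `<=` C -> hull A `<=` C.
Proof. exact: smallest_sub. Qed.

Lemma sub_hull A : A `<=` hull A.
Proof. exact: sub_smallest. Qed.

Lemma hull_convex A : convex_set (hull A).
Proof.
apply/convex_setP => x y t t01 Ax Ay C [C_convex AC].
by move/convex_setP: (C_convex); apply => //; [apply: Ax|apply: Ay].
Qed.

Lemma path_set_sub g C :
  convex_set C -> (forall x, x \in g -> C x) -> path_set g `<=` C.
Proof.
move=> /convex_setP C_convex gC x [/gC //|[a [b [ab_g [t /= t01 <-]]]]].
have sub := mem_infix ab_g.
by apply: C_convex; [rewrite in_itv in t01|apply/gC/sub|apply/gC/sub];
  rewrite ?inE ?eqxx ?orbT.
Qed.

(** Deleting an extreme point from a convex set leaves a convex set, so an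
    extreme point of the hull that were not a vertex could be removed from the
    hull without losing any vertex. *)
Lemma extreme_point_vertex g x : extreme_point (hull (path_set g)) x -> x \in g.
Proof.
move=> [Hx x_extreme]; apply/negPn/negP => xNg.
pose C := [set y | hull (path_set g) y /\ y <> x].
suff /(_ x Hx) [] : hull (path_set g) `<=` C by [].
have C_convex : convex_set C.
  apply/convex_setP => y z t /andP[t0 t1] [Hy yx] [Hz zx]; split.
    by move/convex_setP: (@hull_convex (path_set g)); apply => //; apply/andP.
  move=> xE; move: t0 t1; rewrite le_eqVlt => /predU1P[t0|t0].
    by move=> _; apply: yx; rewrite -xE -t0 subr0 scale1r scale0r addr0.
  rewrite le_eqVlt => /predU1P[t1|t1].
    by apply: zx; rewrite -xE t1 subrr scale1r scale0r add0r.
  by case: (x_extreme y z t) => // /yx.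
apply: hull_sub => //; apply: path_set_sub => // y yg; split.
  by apply: sub_hull; left.
by move=> yx; rewrite -yx yg in xNg.
Qed.

Lemma par_S_gt0 : 0 < (par_S : R).
Proof. by rewrite /par_S /par_p /par_q; lra. Qed.

Lemma par_sqrt : Num.sqrt (par_S : R) ^+ 2 = par_S.
Proof. by rewrite sqr_sqrtr // ltW // par_S_gt0. Qed.

Lemma par_s_gt0 : 0 < (par_s : R).
Proof. by rewrite divr_gt0 ?sqrtr_gt0 ?par_S_gt0 // /par_p; lra. Qed.

Lemma par_c_gt0 : 0 < (par_c : R).
Proof. by rewrite divr_gt0 ?sqrtr_gt0 ?par_S_gt0 // /par_q; lra. Qed.

Lemma par_ss : par_S * (par_s : R) ^+ 2 = 766 ^+ 2.
Proof.
by rewrite /par_s expr_div_n par_sqrt mulrC divfK ?gt_eqF ?par_S_gt0.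
Qed.

Lemma par_cc : par_S * (par_c : R) ^+ 2 = 197 ^+ 2.
Proof.
by rewrite /par_c expr_div_n par_sqrt mulrC divfK ?gt_eqF ?par_S_gt0.
Qed.

Lemma par_sc : par_S * ((par_s : R) * par_c) = 766 * 197.
Proof.
by rewrite /par_s /par_c mulf_div -expr2 par_sqrt mulrC divfK ?gt_eqF //
  par_S_gt0.
Qed.

Lemma par_s2Dc2 : (par_s : R) ^+ 2 + par_c ^+ 2 = 1.
Proof.
apply: (@mulfI _ par_S); first by rewrite gt_eqF ?par_S_gt0.
by rewrite mulrDr par_ss par_cc mulr1.
Qed.

(** The three strict inequalities bounding the triangle by its side lines; the
    normals of the legs are [(par_s, par_c)] and [(- par_s, par_c)]. *)
Definition open_triangle : set plane :=
  [set x | [/\ 0 < x.2, par_s * x.1 + par_c * x.2 < par_s * par_c &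
              - (par_s * x.1) + par_c * x.2 < par_s * par_c]].

Lemma open_triangle_convex : convex_set open_triangle.
Proof.
apply/convex_setP => x y t /andP[t0 t1] [x0 x1 x2] [y0 y1 y2].
have [->|tN0] := eqVneq t 0; first by rewrite subr0 scale1r scale0r addr0.
have t_gt0 : 0 < t by rewrite lt_neqAle eq_sym tN0.
have t1' : 0 <= 1 - t by rewrite subr_ge0.
have comb (a b m : R) : a < m -> b < m -> (1 - t) * a + t * b < m.
  move=> am bm; have -> : m = (1 - t) * m + t * m by ring.
  by rewrite ler_ltD // ?ler_wpM2l // ?ltr_pM2l // ltW.
rewrite /open_triangle /=; split.
- rewrite -oppr_lt0 opprD -!mulrN; apply: comb; by rewrite oppr_lt0.
- have -> : par_s * ((1 - t) * x.1 + t * y.1) +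
      par_c * ((1 - t) * x.2 + t * y.2) =
    (1 - t) * (par_s * x.1 + par_c * x.2) +
      t * (par_s * y.1 + par_c * y.2) by ring.
  exact: comb.
- have -> : - (par_s * ((1 - t) * x.1 + t * y.1)) +
      par_c * ((1 - t) * x.2 + t * y.2) =
    (1 - t) * (- (par_s * x.1) + par_c * x.2) +
      t * (- (par_s * y.1) + par_c * y.2) by ring.
  exact: comb.
Qed.

Lemma open_triangle_sub : open_triangle `<=` triangle.
Proof.
move=> x [x0 x1 x2].
set s : R := par_s in x1 x2 *; set c : R := par_c in x1 x2 *.
have s0 : 0 < s := par_s_gt0; have c0 : 0 < c := par_c_gt0.
have cx : c * x.2 < c * s by nra.
have xs : x.2 < s by rewrite -(ltr_pM2l c0).
(* t is the barycentric coordinate of the apex, and r that of the right end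
   of the base in the remaining combination. *)
pose t := x.2 / s; have tE : x.2 = s * t by rewrite /t mulrC divfK // gt_eqF.
have t1 : t < 1 by rewrite /t ltr_pdivrMr ?mul1r.
have t0 : 0 < t by rewrite divr_gt0.
have x1c : x.1 < c * (1 - t).
  by rewrite -(ltr_pM2l s0); move: x1; rewrite tE; lra.
have x2c : - x.1 < c * (1 - t).
  by rewrite -(ltr_pM2l s0); move: x2; rewrite tE; lra.
have t1' : 0 < 1 - t by rewrite subr_gt0.
pose r := (x.1 / (c * (1 - t)) + 1) / 2.
have d0 : 0 < c * (1 - t) by rewrite mulr_gt0.
have xr : x.1 = (1 - t) * ((1 - r) * (- c) + r * c).
  rewrite /r; field; rewrite gt_eqF //=; lra.
have xd : -1 < x.1 / (c * (1 - t)) < 1.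
  by rewrite ltr_pdivrMr // ltr_pdivlMr // mul1r x1c andbT; lra.
have r01 : 0 <= r <= 1.
  by rewrite /r; move/andP: xd => [? ?]; apply/andP; split; lra.
have vertex z : z \in [:: (- c, 0); (c, 0); (0, s)] -> triangle z.
  by move=> ?; apply: sub_hull.
have /convex_setP tri := @hull_convex
  [set x | x \in [:: (- par_c, 0); (par_c, 0); (0, par_s)]].
have -> : x = (1 - t) *: ((1 - r) *: ((- c, 0) : plane) + r *: ((c, 0) : plane))
    + t *: ((0, s) : plane).
  rewrite !plane_combE /= !mulr0 !addr0 !mulr0 add0r [x]surjective_pairing.
  by rewrite [in LHS]xr [in LHS]tE [t * s]mulrC.
apply: (tri); [by apply/andP; split; exact: ltW|
  |by apply: vertex; rewrite !inE eqxx !orbT].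
by apply: (tri) => //; apply: vertex; rewrite !inE eqxx ?orbT.
Qed.

Lemma open_triangle_open : open open_triangle.
Proof.
have cont (a b : R) : continuous (fun x : plane => a * x.1 + b * x.2).
  move=> x; apply: cvgD; apply: cvgM;
    by first [exact: cvg_cst|exact: cvg_fst|exact: cvg_snd].
have -> : open_triangle =
  ((fun x : plane => 0 * x.1 + 1 * x.2) @^-1` [set y | 0 < y]) `&`
  ((fun x : plane => par_s * x.1 + par_c * x.2)
    @^-1` [set y | y < par_s * par_c]) `&`
  ((fun x : plane => - par_s * x.1 + par_c * x.2)
    @^-1` [set y | y < par_s * par_c]).
  apply/seteqP; split=> x /=; rewrite mul0r add0r mul1r mulNr;
    last by case=> [[]].
  by case=> *; split.
apply: openI; [apply: openI|]; apply: open_comp;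
  by [move=> x _; exact: cont|exact: open_gt|exact: open_lt].
Qed.

Lemma not_escape g a th :
  (forall x, x \in g -> open_triangle (rigid_move a th x)) -> ~ escape g.
Proof.
move=> g_in /(_ a th); apply=> _ [x gx <-].
have C_convex : convex_set (rigid_move a th @^-1` open_triangle).
  apply/convex_setP => y z t t01 Ty Tz; rewrite /preimage /=.
  have -> : rigid_move a th ((1 - t) *: y + t *: z) =
     (1 - t) *: rigid_move a th y + t *: rigid_move a th z.
    by rewrite !plane_combE /rigid_move /=; congr pair; ring.
  by have /convex_setP := open_triangle_convex; apply.
have sub : open_triangle `<=` interior triangle.
  rewrite -open_subsetE; first exact: open_triangle_sub.
  exact: open_triangle_open.
exact/sub/(path_set_sub C_convex g_in).
Qed.

Lemma angle_exists (u v : R) :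
  u ^+ 2 + v ^+ 2 = 1 -> exists th, cos th = u /\ sin th = v.
Proof.
move=> uv; have u1 : -1 <= u <= 1 by apply/andP; split; nra.
have cosu : cos (acos u) = u by rewrite acosK // in_itv.
have sinu : sin (acos u) = `|v|.
  by rewrite sin_acos // -uv addrC addKr sqrtr_sqr.
case: (leP 0 v) => v0; [exists (acos u)|exists (- acos u)].
  by rewrite sinu ger0_norm.
by rewrite cosN sinN sinu ltr0_norm ?opprK.
Qed.

(** The outward normals of the triangle, multiplied by the side lengths
    [1, 1, 2 * par_c], add up to zero; hence the support values of the path in
    these directions, turned by any angle, have a translation invariant sum. A
    sum below twice the area [par_s * par_c] of the triangle would leave room to
    place a copy of the path strictly inside. *)
Lemma escape_support g0 (f : plane -> plane) (u v h1 h2 h3 : R) :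
  escape g0 -> rigid_coordinates f -> u ^+ 2 + v ^+ 2 = 1 ->
  (forall x, x \in map f g0 ->
    [/\ dot x (par_s * u - par_c * v, par_s * v + par_c * u) <= h1,
        dot x (- (par_s * u) - par_c * v, - (par_s * v) + par_c * u) <= h2 &
        dot x (2 * par_c * v, - (2 * par_c * u)) <= h3]) ->
  2 * par_s * par_c <= h1 + h2 + h3.
Proof.
move=> esc [b [th f_rigid]] /angle_exists[phi [<- <-]] {u v} g_support.
rewrite leNgt; apply/negP => small.
set s : R := par_s in g_support small; set c : R := par_c in g_support small.
have s0 : 0 < s := par_s_gt0; have c0 : 0 < c := par_c_gt0.
(* Raising the copy by a2 spends half of the slack above the base; moving it
   sideways by a1 shares the other half equally between the two legs. *)
pose a2 := h3 / (2 * c) + (2 * s * c - h1 - h2 - h3) / (4 * c).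
pose a1 := (h2 - h1) / (2 * s).
have a2E : c * a2 = h3 / 2 + (2 * s * c - h1 - h2 - h3) / 4.
  by rewrite /a2; field; lra.
have a1E : s * a1 = (h2 - h1) / 2 by rewrite /a1; field; lra.
have in_T x : x \in map f g0 -> open_triangle
   (a1 + cos phi * x.1 + sin phi * x.2, a2 - sin phi * x.1 + cos phi * x.2).
  move=> /g_support [k1 k2 k3]; rewrite /dot /= in k1 k2 k3.
  split => /=; rewrite -/s -/c.
  - by rewrite -(pmulr_rgt0 _ c0); lra.
  - lra.
  - lra.
(* The triangle is symmetric, so orientation reversing coordinates are
   corrected by a final reflection. *)
have mirror x : open_triangle x -> open_triangle (- x.1, x.2).
  by move=> [k1 k2 k3]; split => //=; rewrite ?mulrN ?opprK.
case: f_rigid => fE.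
  apply: (@not_escape g0 (a1 + cos phi * b.1 + sin phi * b.2,
    a2 - sin phi * b.1 + cos phi * b.2) (th - phi) _ esc) => x xg.
  have := in_T _ (map_f f xg); rewrite fE; congr open_triangle.
  by rewrite /rigid_move /= cosB sinB; congr pair; ring.
apply: (@not_escape g0 (- (a1 + cos phi * b.1 + sin phi * b.2),
  a2 - sin phi * b.1 + cos phi * b.2) (pi - (th - phi)) _ esc) => x xg.
have := mirror _ (in_T _ (map_f f xg)); rewrite fE; congr open_triangle.
by rewrite /rigid_move /= !(cosB, sinB) sinpi cospi; congr pair; ring.
Qed.

Lemma edist_rigid (f : plane -> plane) x y :
  rigid_coordinates f -> Defs.edist (f x) (f y) = Defs.edist x y.
Proof.
move=> [b [th fE]]; rewrite /Defs.edist; congr Num.sqrt.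
transitivity ((cos th ^+ 2 + sin th ^+ 2) *
  ((x.1 - y.1) ^+ 2 + (x.2 - y.2) ^+ 2)); last by rewrite cos2Dsin2 mul1r.
by case: fE => fE; rewrite !fE /rigid_move /=; ring.
Qed.

Lemma plength_rigid (f : plane -> plane) g :
  rigid_coordinates f -> plength (map f g) = plength g.
Proof.
move=> f_rigid; rewrite /plength size_map; apply: eq_bigr => i _.
have i_lt : (i.+1 < size g)%N by case: (size g) i => [|n] [].
by rewrite !(nth_map 0) ?edist_rigid // ltnW.
Qed.

End Geometry.

(** * Abel summation along a path *)

Section Resultants.
Context {R : realFieldType}.
Implicit Types (d : label -> R * R) (w : label -> R) (s : seq label).
Implicit Types (u v : R * R).

Definition resultant d w s : R * R :=
  (\sum_(l <- s) w l * (d l).1, \sum_(l <- s) w l * (d l).2).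

Definition in_disk (r : R) v : Prop := v.1 ^+ 2 + v.2 ^+ 2 <= r ^+ 2.

Lemma cauchy_plane (a b c e : R) :
  (a * c + b * e) ^+ 2 <= (a ^+ 2 + b ^+ 2) * (c ^+ 2 + e ^+ 2).
Proof.
rewrite -subr_ge0.
have -> : (a ^+ 2 + b ^+ 2) * (c ^+ 2 + e ^+ 2) - (a * c + b * e) ^+ 2 =
  (a * e - b * c) ^+ 2 by ring.
exact: sqr_ge0.
Qed.

Lemma in_disk_add (r t : R) u v : 0 <= r -> 0 <= t ->
  in_disk r u -> in_disk t v -> in_disk (r + t) (u.1 + v.1, u.2 + v.2).
Proof.
rewrite /in_disk /= => r0 t0 ur vt.
have uv : u.1 * v.1 + u.2 * v.2 <= r * t.
  apply: le_trans (ler_norm _) _.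
  rewrite -(ler_pXn2r (n := 2)) ?nnegrE ?mulr_ge0 //.
  rewrite real_normK ?num_real // exprMn.
  apply: le_trans (cauchy_plane _ _ _ _) _.
  by apply: ler_pM => //; rewrite addr_ge0 ?sqr_ge0.
lra.
Qed.

Lemma in_disk_le (r t : R) v : 0 <= r -> r <= t -> in_disk r v -> in_disk t v.
Proof.
rewrite /in_disk => r0 rt /le_trans; apply.
by rewrite ler_pXn2r ?nnegrE // (le_trans r0).
Qed.

Lemma in_disk_scale (a t r : R) v :
  `|a| <= t -> in_disk r v -> in_disk (t * r) (a * v.1, a * v.2).
Proof.
rewrite /in_disk /= => a_t v_r; rewrite !exprMn -mulrDr.
apply: ler_pM; rewrite ?addr_ge0 ?sqr_ge0 //.
by rewrite -real_normK ?num_real // ler_pXn2r ?nnegrE // (le_trans _ a_t).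
Qed.

Lemma resultant_perm d w s s' :
  perm_eq s s' -> resultant d w s = resultant d w s'.
Proof. by move=> ss'; rewrite /resultant !(perm_big _ ss'). Qed.

Lemma resultant_filter d w (p : pred label) s :
  (forall l, ~~ p l -> w l = 0) ->
  resultant d w s = resultant d w [seq l <- s | p l].
Proof.
move=> w0; rewrite /resultant !big_filter; congr pair;
  rewrite (bigID p) /= [X in _ + X]big1 ?addr0 // => l /w0 ->; exact: mul0r.
Qed.

Lemma in_disk_sum (rad : label -> R) (S : R) d w s :
  (forall l, 0 <= rad l) -> 0 <= S ->
  {in s, forall l, in_disk (rad l * S) (w l * (d l).1, w l * (d l).2)} ->
  \sum_(l <- s) rad l <= 1 -> in_disk S (resultant d w s).
Proof.
move=> rad0 S0 s_disk s_le.
suff: in_disk ((\sum_(l <- s) rad l) * S) (resultant d w s).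
  apply: in_disk_le; first by rewrite mulr_ge0 // sumr_ge0.
  by rewrite ler_piMl.
elim: s s_disk {s_le} => [|l s IHs] s_disk.
  by rewrite /in_disk /resultant !big_nil /= mul0r expr0n addr0.
rewrite /resultant !big_cons mulrDl.
apply: (in_disk_add (u := (_, _)) (v := resultant d w s));
  rewrite ?mulr_ge0 ?sumr_ge0 //.
  by apply: s_disk; rewrite inE eqxx.
by apply: IHs => l' l's; apply: s_disk; rewrite inE l's orbT.
Qed.

End Resultants.

Section Abel.
Context {R : realType}.
Local Notation plane := (R * R)%type.

Lemma filter_sorted_drop (T : Type) (pos : T -> nat) (s : seq T) i :
  sorted (fun a b => pos a <= pos b)%N s ->
  [seq a <- s | (i < pos a)%N] = drop (find (fun a => i < pos a)%N s) s.
Proof.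
elim: s => //= a s IHs a_s.
case: ifP => [i_a|_]; last exact/IHs/path_sorted/a_s.
congr cons; apply/all_filterP; move: a_s.
rewrite path_sortedE; last by move=> b c e; exact: leq_trans.
by case/andP=> /sub_all all_s _; apply: all_s => b; exact: leq_trans.
Qed.

Lemma dot_le_edist (x y v : plane) :
  in_disk 1 v -> (y.1 - x.1) * v.1 + (y.2 - x.2) * v.2 <= Defs.edist x y.
Proof.
rewrite /in_disk expr1n => v1; apply: le_trans (ler_norm _) _.
rewrite -sqrtr_sqr /Defs.edist; apply: ler_wsqrtr.
set a := y.1 - x.1; set b := y.2 - x.2.
have -> : (x.1 - y.1) ^+ 2 + (x.2 - y.2) ^+ 2 = a ^+ 2 + b ^+ 2.
  by rewrite /a /b; ring.
apply: le_trans (cauchy_plane _ _ _ _) _.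
by rewrite ler_piMr // addr_ge0 ?sqr_ge0.
Qed.

Lemma telescope_ord (f : nat -> R) (j N : nat) : (j <= N)%N ->
  f j = f 0%N + \sum_(i < N) (if (i < j)%N then f i.+1 - f i else 0).
Proof.
move=> jN; rewrite -big_mkcond -(big_ord_widen N (fun i => f i.+1 - f i) jN).
by rewrite -(big_mkord xpredT (fun i => f i.+1 - f i)) telescope_sumr // subrKC.
Qed.

(** Moving from the start of the path to the contact of [l] crosses exactly the
    links [i] with [i] below the position of the contact. Exchanging the two
    sums collects, for each link, the labels that are visited after it; since
    [ord] follows the path, these form a suffix of [ord]. *)
Lemma weighted_contacts_le_plength (g : seq plane) (ord : seq label)
    (pt d : label -> plane) (w : label -> R) :
  (forall l, pt l \in g) ->
  sorted (fun l l' => index (pt l) g <= index (pt l') g)%N ord ->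
  resultant d w ord = (0, 0) ->
  (forall k, in_disk 1 (resultant d w (drop k ord))) ->
  \sum_(l <- ord) w l * dot (pt l) (d l) <= plength g.
Proof.
move=> pt_g ord_sorted [w1 w2] w_disk.
pose x i := nth 0 g i; pose pos l := index (pt l) g.
have pos_lt l : (pos l <= (size g).-1)%N.
  by have := pt_g l; rewrite -index_mem /pos; case: (size g).
have step l : w l * dot (pt l) (d l) =
    (x 0%N).1 * (w l * (d l).1) + (x 0%N).2 * (w l * (d l).2) +
    \sum_(i < (size g).-1) (if (i < pos l)%N then
      ((x i.+1).1 - (x i).1) * (w l * (d l).1) +
      ((x i.+1).2 - (x i).2) * (w l * (d l).2) else 0).
  rewrite /dot -(nth_index 0 (pt_g l)) -/(pos l) -/(x _).
  rewrite (telescope_ord (fun i => (x i).1) (pos_lt l)).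
  rewrite (telescope_ord (fun i => (x i).2) (pos_lt l)).
  set S1 := \sum_(i < _) _; set S2 := \sum_(i < _) _; set S3 := \sum_(i < _) _.
  have -> : S3 = S1 * (w l * (d l).1) + S2 * (w l * (d l).2).
    rewrite !mulr_suml -big_split; apply: eq_bigr => i _.
    by case: ifP => //=; rewrite !mul0r addr0.
  by ring.
rewrite (eq_bigr _ (fun l _ => step l)) big_split /=.
rewrite big_split -!mulr_sumr /= w1 w2 !mulr0 !add0r exchange_big /=.
apply: ler_sum => i _.
rewrite -big_mkcond -big_filter filter_sorted_drop // big_split /= -!mulr_sumr.
exact: dot_le_edist (w_disk _).
Qed.

End Abel.

(** * Shapes of the unvisited sets *)

Local Open Scope nat_scope.

(** A set of labels is encoded by the list of its elements in fan order. *)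
Definition canon (s : seq label) : seq label := [seq l <- fan | l \in s].

Lemma canonP s l : (l \in canon s) = (l \in s).
Proof. by rewrite mem_filter andbC; case: l. Qed.

Lemma canon_perm s : uniq s -> perm_eq s (canon s).
Proof.
move=> s_uniq; apply: uniq_perm => //; first by rewrite filter_uniq.
by move=> l; rewrite canonP.
Qed.

(** All cyclic intervals of the fan, so that statements about them can be
    checked by computation. *)
Definition arcs : seq (seq label) :=
  [seq canon (take n (rot i fan)) | i <- iota 0 19, n <- iota 0 20].

Lemma canon_arc s : cyclic_interval s -> canon s \in arcs.
Proof.
move=> [i [n /eq_filter s_eq]].
have -> : canon s = canon (take n (rot i fan)) by exact: s_eq.
have -> : take n (rot i fan) = take (minn n 19) (rot i fan).
  case: (leqP n 19) => // n_big.
  rewrite !take_oversize ?size_rot //; exact: ltnW.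
have [i' i'_lt ->] : exists2 i', i' < 19 & rot i fan = rot i' fan.
  case: (ltnP i 19) => i_big; first by exists i.
  by exists 0; rewrite // rot0 rot_oversize.
apply: (@allpairs_f _ _ _ (fun i n => canon (take n (rot i fan)))).
  by rewrite mem_iota.
by rewrite mem_iota /= ltnS geq_minr.
Qed.

Definition right_chain : seq label := [:: LV; LZ1; LP2; LAL; LE1; LE4; LBR].
Definition left_chain : seq label := [:: LBL; LE2; LE3; LAR; LQ3; LZ2; LW].
Definition subintervals (s : seq label) : seq (seq label) :=
  [seq take n (drop i s) | i <- iota 0 8, n <- iota 0 8].

Lemma arcs_check (p q : pred (seq label)) :
  all (fun a => p a ==> q a) arcs ->
  forall s, cyclic_interval s -> p (canon s) -> q (canon s).
Proof. by move=> /allP pq s /canon_arc /pq /implyP. Qed.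

Lemma mem_drop_index (T : eqType) (s : seq T) k x :
  uniq s -> x \in s -> (x \in drop k s) = (k <= index x s).
Proof.
move=> s_uniq xs; rewrite leqNgt -in_take //.
move: s_uniq xs; rewrite -{1 2}(cat_take_drop k s) cat_uniq mem_cat.
move=> /and3P[_ /hasPn disj _].
case: (boolP (x \in take k s)) => /= [x_take _|_ -> //].
by apply/negP => /disj; rewrite x_take.
Qed.

Section DequeOrder.
Variable ord : seq label.
Hypotheses (ord_perm : perm_eq ord fan)
  (ord_arcs : forall k, cyclic_interval (drop k ord)).
Local Notation pos l := (index l ord).
Hypotheses (FM : pos LF < pos LM) (MT : pos LM < pos LT)
  (UT : pos LU < pos LT) (TV : pos LT < pos LV)
  (WF : pos LW < pos LF) (FX : pos LF < pos LX) (XT : pos LX < pos LT).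

Lemma mem_suffix k l : (l \in canon (drop k ord)) = (k <= pos l).
Proof.
rewrite canonP mem_drop_index ?(perm_uniq ord_perm) // (perm_mem ord_perm).
by case: l.
Qed.

(** When F has just been visited, the unvisited labels form a cyclic interval
    that contains X, M and T but neither F, the successor of T, nor W, the
    predecessor of X; only the interval from X to T qualifies. *)
Lemma after_F l : (pos LF < pos l) = (l \in drop 8 fan).
Proof.
rewrite -mem_suffix; congr (l \in _); apply/eqP.
pose p (a : seq label) :=
  [&& LX \in a, LM \in a, LT \in a, LF \notin a & LW \notin a].
apply: (arcs_check (p := p) (q := pred1 (drop 8 fan)) _ (ord_arcs _)).
  by vm_compute.
rewrite /p !mem_suffix FX FM (ltn_trans FM MT) ltnn /= -leqNgt; exact: ltnW.
Qed.

(** The three cases are the stages before F, between F and T, and after T. *)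
Lemma suffix_shape k :
  [\/ [seq l <- fan | l \notin canon (drop k ord)] \in subintervals left_chain,
      canon (drop k ord) \in [seq drop i fan | i <- iota 8 4] |
      canon (drop k ord) \in subintervals right_chain].
Proof.
case: (leqP k (pos LF)) => [k_F|F_k].
  apply: Or31; pose p (a : seq label) := all (mem a) (LF :: drop 8 fan).
  apply: (arcs_check (p := p) (q := fun a : seq label =>
    [seq l <- fan | l \notin a] \in subintervals left_chain) _ (ord_arcs _)).
    by vm_compute.
  apply/allP => l; rewrite in_cons -after_F => /predU1P[->|F_l];
    rewrite inE mem_suffix //; exact: leq_trans k_F (ltnW F_l).
case: (leqP k (pos LT)) => [k_T|T_k].
  apply: Or32; pose p (a : seq label) :=
    [&& LF \notin a, LW \notin a, LT \in a & LV \in a].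
  apply: (arcs_check (p := p) (q := fun a : seq label =>
    a \in [seq drop i fan | i <- iota 8 4]) _ (ord_arcs _)).
    by vm_compute.
  rewrite /p !mem_suffix -!ltnNge F_k (ltn_trans WF F_k) k_T /=.
  exact: leq_trans k_T (ltnW TV).
apply: Or33; pose p (a : seq label) :=
  ~~ has (mem a) (take 8 fan ++ [:: LX; LM; LU; LT]).
apply: (arcs_check (p := p) (q := fun a : seq label =>
  a \in subintervals right_chain) _ (ord_arcs _)).
  by vm_compute.
apply/hasPn => l l_in; suff: pos l < k by rewrite ltnNge -mem_suffix.
move: l_in; rewrite mem_cat => /orP[l_left|].
  by apply: leq_ltn_trans F_k; rewrite leqNgt after_F; case: l l_left.
by rewrite !inE => /or4P[] /eqP-> //; exact: ltn_trans T_k.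
Qed.

End DequeOrder.

Local Close Scope nat_scope.

Section Complement.
Context {R : realFieldType}.
Implicit Types (d : label -> R * R) (w : label -> R) (s : seq label).

(** Complementary resultants are opposite. *)
Lemma complement_disk d w s (r : R) : resultant d w fan = (0, 0) ->
  in_disk r (resultant d w [seq l <- fan | l \notin s]) ->
  in_disk r (resultant d w (canon s)).
Proof.
case=> e1 e2; rewrite /in_disk /resultant !big_filter /=.
move/eqP: e1; rewrite (bigID (mem s)) addr_eq0 /= => /eqP->.
by move/eqP: e2; rewrite (bigID (mem s)) addr_eq0 /= => /eqP->; rewrite !sqrrN.
Qed.

End Complement.

(** * Weights and directions *)

Section Weights.
Context {R : realFieldType}.

(** Satisfied by the points [(cos th / par_s, sin th / par_c)] with [th] between
    [- eta] and [eta]. The equation is [cos2Dsin2], because [par_s] and [par_c]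
    are proportional to 766 and 197. In these coordinates the directions become
    polynomials with rational coefficients. The last two conditions bracket
    [k - 1], which is about [197 ^+ 2 / (2 * 766 ^+ 2) * (1 - s ^+ 2)]. *)
Definition arc_point (k s : R) : Prop :=
  [/\ 0 <= 1 - s, 0 <= 1 + s,
      k ^+ 2 * 766 ^+ 2 - 766 ^+ 2 - 197 ^+ 2 * (1 - s ^+ 2) = 0,
      0 <= k - 1 - 4 / 125 * (1 - s ^+ 2) &
      0 <= 17 / 500 * (1 - s ^+ 2) - (k - 1)].

(** The directions multiplied by [par_S], which clears all denominators. The
    labels M, E1, E2, E3 and E4, of weight 0 below, have a dummy direction. *)
Definition scaled_direction (kR sR kL sL : R) (l : label) : R * R :=
  let a : R := 766 * 197 in let b : R := 766 ^+ 2 in let e : R := 197 ^+ 2 in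
  match l with
  | LF | LT => (0, - (b + e))
  | LZ1 => (2 * a, b - e)
  | LZ2 => (- (2 * a), b - e)
  | LP2 => (2 * a, 2 * e)
  | LQ3 => (- (2 * a), 2 * e)
  | LU | LV => (a * (kR - sR), b * kR + e * sR)
  | LW | LX => (- (a * (kL - sL)), b * kL + e * sL)
  | LAR => (- (2 * a * kR), - (2 * e * sR))
  | LBR => (a * (kR + sR), e * sR - b * kR)
  | LAL => (2 * a * kL, - (2 * e * sL))
  | LBL => (- (a * (kL + sL)), e * sL - b * kL)
  | _ => (0, 0)
  end.

Definition anchor_weight : R := 153 / 400.
Definition delimiter_weight : R := 31 / 50.

(** The weight of a delimiter normal is divided between the two ends of the gap:
    [split_weight s s'] goes to the end far from M, where [s] and [s'] are the
    sines, divided by [par_c], of the angles of this gap and of the other. The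
    coefficients approximately minimize the largest norm of a resultant. *)
Definition split_weight (s s' : R) : R := 1 / 5 + 3 / 20 * s + 3 / 40 * s'.

Definition weight (sR sL : R) (l : label) : R :=
  match l with
  | LF | LT | LZ1 | LZ2 | LP2 | LQ3 => anchor_weight
  | LAR | LBR | LAL | LBL => delimiter_weight
  | LV => split_weight sR sL
  | LU => delimiter_weight - split_weight sR sL
  | LW => split_weight sL sR
  | LX => delimiter_weight - split_weight sL sR
  | _ => 0
  end.

End Weights.

(** * Resultants in the disk *)

Section PolynomialBounds.
Context {R : realFieldType}.
Variables (kR sR kL sL : R).
Hypotheses (arcR : arc_point kR sR) (arcL : arc_point kL sL).
Let d := scaled_direction kR sR kL sL.
Let w := weight sR sL.
Let S : R := 766 ^+ 2 + 197 ^+ 2.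

Let p2 (a b : R) : 0 <= a -> 0 <= b -> 0 <= a * b.
Proof. exact: mulr_ge0. Qed.

Let p3 (a b c : R) : 0 <= a -> 0 <= b -> 0 <= c -> 0 <= a * b * c.
Proof. by move=> *; rewrite !mulr_ge0. Qed.

Let eqM (a b : R) : a = 0 -> b * a = 0.
Proof. by move=> ->; rewrite mulr0. Qed.

Let arc_point_ge1 (k s : R) : arc_point k s -> 0 <= k - 1.
Proof. by move=> [h1 h2 _ h3 _]; move: (p2 h1 h2); lra. Qed.

(** Each bound below is certified by writing the slack, up to multiples of the
    two equations [eR] and [eL], as a nonnegative combination of products of the
    constraints on the box of parameters: [a1], [a2], [da], [la], [ua] concern
    [sR] and [kR], [b1], [b2], [db], [lb], [ub] concern [sL] and [kL], and the
    others are squares, which supply what these products lack where the slack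
    is smallest inside the box. The products listed in each proof are those of
    the certificate. *)
Ltac box_constraints :=
  have da := arc_point_ge1 arcR; have db := arc_point_ge1 arcL;
  case: arcR arcL => [a1 a2 eR la ua] [b1 b2 eL lb ub];
  have q0 := sqr_ge0 sL; have r0 := sqr_ge0 sR;
  have qm := sqr_ge0 (sL + 1 / 5); have qp := sqr_ge0 (sL - 1 / 2);
  have rl := sqr_ge0 (sR - sL); have rm := sqr_ge0 (sR - 1 / 2);
  rewrite /in_disk /resultant !big_cons !big_nil /w /d /S /=;
  rewrite /anchor_weight /delimiter_weight /split_weight.

Lemma disk_V_AL : in_disk S (resultant d w [:: LV; LZ1; LP2; LAL]).
Proof.
box_constraints.
move: (p3 a1 a1 a1) (p3 a1 a1 a2) (p3 a1 a2 a2) (p3 a1 b1 b1) (p3 a1 b1 b2)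
  (p3 a2 a2 a2) (p3 a2 b1 b1) (p3 da a1 a2) (p3 da a1 b1) (p3 da db a1)
  (p3 da db b1) (p3 da ub b1) (p3 da ub b2) (p3 db a1 b1) (p3 db b1 b2)
  (p3 la a1 a1) (p3 lb a1 a1) (p3 lb b2 b2) (p2 qm a2) (p2 qm da) (p2 qp b1)
  (p2 rl a1) (p2 rl lb) (p3 ua a2 a2) (p3 ua b1 b1) (p3 ua b1 b2)
  (p3 ua b2 b2) (p3 ub a1 b2) (p3 ub a2 a2) (p3 ub b1 b1)
  (eqM sR eR) (eqM sL eR) (eqM (sR ^+ 2) eR) (eqM (sL ^+ 2) eR)
  (eqM (sR * sL) eR) => *.
lra.
Qed.

Lemma disk_V_BR : in_disk S (resultant d w [:: LV; LZ1; LP2; LAL; LBR]).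
Proof.
box_constraints.
move: (p3 a1 a1 a2) (p3 a1 a1 b1) (p3 a1 a1 b2) (p3 a1 a2 b1) (p3 a1 a2 b2)
  (p3 a1 b1 b2) (p3 a2 b1 b1) (p3 a2 b2 b2) (p3 b1 b1 b1) (p3 b2 b2 b2)
  (p3 da a2 b2) (p3 da b1 b1) (p3 da db a1) (p3 da db b1) (p3 db a1 b1)
  (p3 la a1 a2) (p3 la a1 b1) (p3 la a2 a2) (p3 la b2 b2) (p3 ua a2 b2)
  (p3 ua b1 b1) (p3 ua db a1) (p3 ua db a2) (p3 ub a1 a1) (p3 ub a1 a2)
  (p3 ub a2 a2)
  (eqM sR eR) (eqM sL eR) (eqM (sR ^+ 2) eR) (eqM (sL ^+ 2) eR)
  (eqM (sR * sL) eR) => *.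
lra.
Qed.

Lemma disk_Z1_BR : in_disk S (resultant d w [:: LZ1; LP2; LAL; LBR]).
Proof.
box_constraints.
move: (p2 a1 a1) (p2 a1 a2) (p2 a1 b1) (p2 da a1) (p2 da b1) (p2 da ub)
  (p2 la a2) (p2 qm b1) (p2 qm b2) (p2 qm ua) (p2 qp b1) (p2 qp la) (p2 rl a2)
  (p2 rl b2) (p2 rm a1) (p2 rm b2) (p2 ub a1) (p2 ub a2) => *.
lra.
Qed.

Lemma disk_P2_BR : in_disk S (resultant d w [:: LP2; LAL; LBR]).
Proof.
box_constraints.
move: (p2 a1 a2) (p2 a1 b1) (p2 b1 b2) (p2 b2 b2) (p2 qp a2) (p2 qp b1)
  (p2 rl a2) (p2 rl b2) (p2 rm a1) (p2 rm b2) (p2 rm db) (p2 ua b2) (p2 ua db)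
  (p2 ub a1) (p2 ub a2) => *.
lra.
Qed.

(** The unvisited labels while the path runs from U to T. *)
Lemma disk_V_T : in_disk S (resultant d w [:: LV; LZ1; LP2; LAL; LBR; LT]).
Proof.
box_constraints.
move: (p3 a1 a1 a2) (p3 a1 a1 b1) (p3 a1 a1 b2) (p3 a1 a2 b1) (p3 a2 a2 a2)
  (p3 b1 b1 b1) (p3 da a2 b2) (p3 da b1 b1) (p3 da db a1) (p3 da db b1)
  (p3 db a1 b1) (p2 qm a2) (p2 qp b2) (p2 rl a1) (p2 rm b2) (p3 ua a1 a1)
  (p3 ua a1 a2) (p3 ua a2 a2) (p3 ua b1 b1) (p3 ua b2 b2) (p3 ua db a1)
  (p3 ua db a2) (p3 ub a1 a1) (p3 ub a1 a2) (p3 ub a2 a2)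
  (eqM sR eR) (eqM sL eR) (eqM (sR ^+ 2) eR) (eqM (sL ^+ 2) eR)
  (eqM (sR * sL) eR) => *.
lra.
Qed.

(** The unvisited labels while the path runs from X to U. *)
Lemma disk_U_T : in_disk S (resultant d w [:: LU; LV; LZ1; LP2; LAL; LBR; LT]).
Proof.
box_constraints.
move: (p2 a1 a1) (p2 a1 a2) (p2 a2 a2) (p2 a2 b2) (p2 b2 b2) (p2 da ub)
  (p2 qm a2) (p2 qp a1) (p2 qp da) (p2 rl a2) (p2 rm a1) (p2 ua b1) (p2 ua b2)
  (p2 ub b1) (p2 ub b2) => *.
lra.
Qed.

End PolynomialBounds.

Section Certificate.
Context {R : realFieldType}.
Implicit Types (kR sR kL sL : R).
Local Notation S := (766 ^+ 2 + 197 ^+ 2 : R).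
Local Notation scaled_resultant kR sR kL sL s :=
  (resultant (scaled_direction kR sR kL sL) (weight sR sL) s).

(** Upper bounds for the norms of the weighted directions. The bases of the
    triangles have length [2 * par_c], which is just below 1/2. *)
Definition radius (l : label) : R :=
  match l with
  | LV => 17 / 40
  | LZ1 => 153 / 400
  | LP2 => 153 / 800
  | LAL => 31 / 100
  | LBR => 31 / 50
  | _ => 0
  end.

Lemma radius_disk kR sR kL sL : arc_point kR sR -> arc_point kL sL ->
  {in [:: LV; LZ1; LP2; LAL; LBR], forall l, in_disk (radius l * S)
    (weight sR sL l * (scaled_direction kR sR kL sL l).1,
     weight sR sL l * (scaled_direction kR sR kL sL l).2)}.
Proof.
move=> [a1 a2 eR _ _] [b1 b2 eL _ _].
have scale l (a r : R) : radius l * S = a * r -> `|weight sR sL l| <= a ->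
    in_disk r (scaled_direction kR sR kL sL l) -> in_disk (radius l * S)
    (weight sR sL l * (scaled_direction kR sR kL sL l).1,
     weight sR sL l * (scaled_direction kR sR kL sL l).2).
  by move=> ->; exact: in_disk_scale.
move=> l; rewrite !inE => /or4P[/eqP->|/eqP->|/eqP->|/orP[] /eqP->].
- apply: (scale _ (17 / 40) S) => //=.
    by rewrite /split_weight ler_norml; apply/andP; split; lra.
  rewrite /in_disk /=; lra.
- apply: (scale _ (153 / 400) S);
    rewrite /in_disk /= /anchor_weight ?ger0_norm; lra.
- apply: (scale _ (153 / 400) (1 / 2 * S));
    rewrite /in_disk /= /anchor_weight ?ger0_norm; lra.
- apply: (scale _ (31 / 50) (1 / 2 * S));
    rewrite /in_disk /= /delimiter_weight ?ger0_norm; lra.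
- apply: (scale _ (31 / 50) S);
    rewrite /in_disk /= /delimiter_weight ?ger0_norm; lra.
Qed.

Definition weighted (l : label) : bool :=
  l \notin [:: LM; LE1; LE2; LE3; LE4].

Lemma unweighted sR sL l : ~~ weighted l -> weight sR sL l = 0.
Proof. by case: l. Qed.

(** Without the weightless labels E1 and E4 the right chain has sixteen
    intervals. The norms of the weighted directions add up to at most 1 on all
    but the four that the polynomial bounds cover. *)
Lemma right_disk kR sR kL sL s : arc_point kR sR -> arc_point kL sL ->
  s \in subintervals right_chain -> in_disk S (scaled_resultant kR sR kL sL s).
Proof.
move=> arcR arcL s_int; rewrite (resultant_filter _ _ (@unweighted sR sL)).
have : [seq l <- s | weighted l] \in
    [:: [:: LV; LZ1; LP2; LAL]; [:: LV; LZ1; LP2; LAL; LBR];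
        [:: LZ1; LP2; LAL; LBR]; [:: LP2; LAL; LBR];
        [::]; [:: LV]; [:: LZ1]; [:: LP2]; [:: LAL]; [:: LBR];
        [:: LV; LZ1]; [:: LV; LZ1; LP2]; [:: LZ1; LP2]; [:: LZ1; LP2; LAL];
        [:: LP2; LAL]; [:: LAL; LBR]].
  by move: s s_int; apply/allP; vm_compute.
have small t : {subset t <= [:: LV; LZ1; LP2; LAL; LBR]} ->
    \sum_(l <- t) radius l <= 1 -> in_disk S (scaled_resultant kR sR kL sL t).
  move=> t_sub; apply: in_disk_sum.
  - by case=> /=; lra.
  - lra.
  - by move=> l /t_sub; exact: radius_disk.
rewrite 4!in_cons => /predU1P[->|]; first exact: disk_V_AL.
move=> /predU1P[->|]; first exact: disk_V_BR.
move=> /predU1P[->|]; first exact: disk_Z1_BR.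
move=> /predU1P[->|]; first exact: disk_P2_BR.
move=> s_small; apply: small; move: (seq.filter _ s) s_small.
  by move=> t t_small; apply/allP; move: t t_small; apply/allP; vm_compute.
by move=> t; rewrite !in_cons in_nil orbF;
  do ![case/predU1P=> [->|]]; try move/eqP->; rewrite ?big_cons big_nil /=; lra.
Qed.

(** The labels are exchanged by the reflection in a vertical line. *)
Definition mirror (l : label) : label :=
  match l with
  | LF => LT | LBL => LBR | LE2 => LE4 | LE3 => LE1 | LAR => LAL | LQ3 => LP2
  | LZ2 => LZ1 | LW => LV | LX => LU | LM => LM | LU => LX | LV => LW
  | LZ1 => LZ2 | LP2 => LQ3 | LAL => LAR | LE1 => LE3 | LE4 => LE2 | LBR => LBL
  | LT => LF
  end.

(** The list is reversed because the reflection reverses the fan order. *)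
Lemma mirror_disk kR sR kL sL s :
  in_disk S (scaled_resultant kL sL kR sR (rev (map mirror s))) ->
  in_disk S (scaled_resultant kR sR kL sL s).
Proof.
have rev_perm : perm_eq (rev (map mirror s)) (map mirror s).
  by rewrite perm_rev.
rewrite (resultant_perm _ _ rev_perm) /resultant !big_map /in_disk /=.
have -> : \sum_(l <- s) weight sL sR (mirror l) *
      (scaled_direction kL sL kR sR (mirror l)).1 =
    - \sum_(l <- s) weight sR sL l * (scaled_direction kR sR kL sL l).1.
  by rewrite -sumrN; apply: eq_bigr; case=> _ /=; ring.
have -> : \sum_(l <- s) weight sL sR (mirror l) *
      (scaled_direction kL sL kR sR (mirror l)).2 =
    \sum_(l <- s) weight sR sL l * (scaled_direction kR sR kL sL l).2.
  by apply: eq_bigr; case.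
by rewrite sqrrN.
Qed.

Lemma resultant_fan kR sR kL sL : scaled_resultant kR sR kL sL fan = (0, 0).
Proof. by rewrite /resultant !big_cons !big_nil /=; congr pair; ring. Qed.

Lemma middle_disk kR sR kL sL s : arc_point kR sR -> arc_point kL sL ->
  s \in [seq drop i fan | i <- iota 8 4] ->
  in_disk S (scaled_resultant kR sR kL sL s).
Proof.
move=> arcR arcL; rewrite /= !inE => /or4P[] /eqP->.
(* The complement of the interval from X to T mirrors the one from V to T. *)
- apply: (complement_disk (s := drop 8 fan) (resultant_fan _ _ _ _)).
  apply: mirror_disk.
  rewrite (resultant_filter _ _ (@unweighted sL sR)); exact: disk_V_T.
- rewrite (resultant_filter _ _ (@unweighted sR sL)); exact: disk_U_T.
- rewrite (resultant_filter _ _ (@unweighted sR sL)); exact: disk_U_T.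
- rewrite (resultant_filter _ _ (@unweighted sR sL)); exact: disk_V_T.
Qed.

Lemma suffix_disk kR sR kL sL s :
  arc_point kR sR -> arc_point kL sL -> uniq s ->
  [\/ [seq l <- fan | l \notin canon s] \in subintervals left_chain,
      canon s \in [seq drop i fan | i <- iota 8 4] |
      canon s \in subintervals right_chain] ->
  in_disk S (scaled_resultant kR sR kL sL s).
Proof.
move=> arcR arcL s_uniq; rewrite (resultant_perm _ _ (canon_perm s_uniq)).
case=> [s_left|s_mid|s_right].
- have -> : canon s = canon (canon s) by apply: eq_filter => l; rewrite canonP.
  apply: (complement_disk (resultant_fan _ _ _ _)); apply: mirror_disk.
  apply: right_disk => //.
  by move: (seq.filter _ _) s_left; apply/allP; vm_compute.
- exact: middle_disk.
- exact: right_disk.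
Qed.

End Certificate.

(** * The delimiter angles *)

Section Angles.
Context {R : realType}.

Lemma sqrt_ratio :
  Num.sqrt (1 + (par_p / par_q : R) ^+ 2) = Num.sqrt par_S / par_q.
Proof.
have q0 : 0 < (par_q : R) by rewrite /par_q; lra.
have -> : 1 + (par_p / par_q : R) ^+ 2 = par_S * par_q^-1 ^+ 2.
  by rewrite /par_S; field; lra.
by rewrite sqrtrM ?(ltW par_S_gt0) // sqrtr_sqr ger0_norm // invr_ge0 ltW.
Qed.

Lemma cos_beta : cos (beta : R) = par_c.
Proof. by rewrite /beta cos_atan sqrt_ratio invf_div. Qed.

Lemma beta_bounds : 0 < (beta : R) < pi / 2.
Proof.
rewrite /beta -[X in X < _]atan0 lt_atan ?atan_ltpi2 //.
by apply: divr_gt0; rewrite /par_p /par_q; lra.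
Qed.

Lemma sin_beta : sin (beta : R) = par_s.
Proof.
have /andP[b0 b1] := beta_bounds.
have sb0 : 0 <= sin (beta : R).
  by apply: sin_ge0_pi; rewrite ltW //=; have := @pi_gt0 R; lra.
apply/eqP; rewrite -(@eqrXn2 _ 2) // ?(ltW par_s_gt0) //; apply/eqP.
by rewrite sin2cos2 cos_beta -par_s2Dc2 addrK.
Qed.

(** Here [- eta <= th <= eta] gives [|sin th| <= sin eta = par_c]; the last part
    is the half-angle parametrisation of the circle. *)
Lemma delimiter_angle (th : R) : - eta <= th <= eta ->
  [/\ 0 < cos th, - par_c <= sin th <= par_c &
      forall t, t = tan (th / 2) ->
        (1 - t ^+ 2) / (1 + t ^+ 2) = cos th /\
        2 * t / (1 + t ^+ 2) = sin th].
Proof.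
have /andP[b0 b1] := beta_bounds; have pi0 := @pi_gt0 R.
have sin_eta : sin (eta : R) = par_c.
  by rewrite /eta sinB sin_pihalf cos_pihalf mul1r mul0r subr0 cos_beta.
have eta0 : 0 < (eta : R) by rewrite /eta; lra.
have eta1 : (eta : R) < pi / 2 by rewrite /eta; lra.
move=> /andP[th0 th1]; split.
- by apply: cos_gt0_pihalf; apply/andP; split; lra.
- have mono (x y : R) :
      - (pi / 2) <= x -> x <= y -> y <= pi / 2 -> sin x <= sin y.
    move=> x0 + y0; rewrite le_eqVlt => /predU1P[->//|xy].
    by apply: ltW; rewrite ltr_sin // in_itv /=; apply/andP; split; lra.
  by rewrite -sin_eta -sinN !mono //; lra.
move=> t tE; have half : th = th / 2 + th / 2 by rewrite -splitr.
have C0 : cos (th / 2) != 0.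
  by rewrite gt_eqF //; apply: cos_gt0_pihalf; apply/andP; split; lra.
have := cos2Dsin2 (th / 2); move: C0.
rewrite [in cos th]half [in sin th]half cosD sinD tE /tan.
set C := cos _; set D := sin _ => C0 CD.
have k0 : 1 + (D / C) ^+ 2 = (C ^+ 2)^-1.
  by transitivity ((C ^+ 2 + D ^+ 2) / C ^+ 2); [field|rewrite CD mul1r].
by rewrite k0; split; rewrite invrK; field.
Qed.

(** The bracket for [k - 1] comes from [(k - 1) * (k + 1)] being
    [197 ^+ 2 / 766 ^+ 2 * (1 - u ^+ 2)], with [k + 1] between 2 and 2.04. *)
Lemma delimiter_arc_point (th : R) :
  - eta <= th <= eta -> arc_point (cos th / par_s) (sin th / par_c).
Proof.
move=> /delimiter_angle[C0 /andP[D0 D1] _].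
have s0 := @par_s_gt0 R; have c0 := @par_c_gt0 R.
set k := cos th / _; set u := sin th / _.
have kE : cos th = par_s * k by rewrite /k mulrC divfK ?gt_eqF.
have uE : sin th = par_c * u by rewrite /u mulrC divfK ?gt_eqF.
have k_gt0 : 0 < k by rewrite divr_gt0.
have u1 : 0 <= 1 - u by rewrite subr_ge0 /u ler_pdivrMr ?mul1r.
have u2 : 0 <= 1 + u by rewrite -lerBlDl sub0r /u ler_pdivlMr // mulN1r.
have eq : k ^+ 2 * 766 ^+ 2 - 766 ^+ 2 - 197 ^+ 2 * (1 - u ^+ 2) = 0.
  have ku : par_s ^+ 2 * k ^+ 2 + par_c ^+ 2 * u ^+ 2 = 1.
    by rewrite -!exprMn -kE -uE cos2Dsin2.
  have : par_S * par_s ^+ 2 * k ^+ 2 + par_S * par_c ^+ 2 * u ^+ 2 = par_S.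
    by rewrite -[RHS]mulr1 -ku; ring.
  by rewrite par_ss par_cc /par_S /par_p /par_q; lra.
have y0 : 0 <= 1 - u ^+ 2 by nra.
have k1 : 0 <= k - 1 by nra.
have k_le : 0 <= 17 / 500 * (1 - u ^+ 2) - (k - 1).
  by have := sqr_ge0 (k - 1); lra.
have k_ub : 0 <= 17 / 500 - (k - 1) by have := sqr_ge0 u; lra.
by split=> //; have := mulr_ge0 k1 k_ub; lra.
Qed.

End Angles.

(** * The length bound *)

Section Assembly.
Context {R : realType}.
Local Notation plane := (R * R)%type.
Variables (thR thL tR tL : R).
Hypotheses (thR_range : - eta <= thR <= eta) (thL_range : - eta <= thL <= eta)
  (tRE : tR = tan (thR / 2)) (tLE : tL = tan (thL / 2)).
Local Notation s := (@par_s R).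
Local Notation c := (@par_c R).

Definition trig_direction (l : label) : plane :=
  match l with
  | LF | LT => (0, - 1)
  | LZ1 => (2 * s * c, s ^+ 2 - c ^+ 2)
  | LZ2 => (- (2 * s * c), s ^+ 2 - c ^+ 2)
  | LP2 => (2 * s * c, 2 * c ^+ 2)
  | LQ3 => (- (2 * s * c), 2 * c ^+ 2)
  | LU | LV => (c * cos thR - s * sin thR, s * cos thR + c * sin thR)
  | LW | LX => (- (c * cos thL - s * sin thL), s * cos thL + c * sin thL)
  | LAR => (- (2 * c * cos thR), - (2 * c * sin thR))
  | LBR => (c * cos thR + s * sin thR, c * sin thR - s * cos thR)
  | LAL => (2 * c * cos thL, - (2 * c * sin thL))
  | LBL => (- (c * cos thL + s * sin thL), c * sin thL - s * cos thL)
  | _ => (0, 0)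
  end.

Lemma directionE l : weighted l -> direction thR thL tR tL l = trig_direction l.
Proof.
have [_ _ /(_ _ tRE) [CR SR]] := delimiter_angle thR_range.
have [_ _ /(_ _ tLE) [CL SL]] := delimiter_angle thL_range.
have scaleE (a x y : R) : a *: ((x, y) : plane) = (a * x, a * y) by [].
case: l => // _; rewrite /direction /= ?scaleE ?CR ?SR ?CL ?SL;
  rewrite /unit_vec /rho /kappa /chi //.
- by congr pair; rewrite /s /c; ring.
- by congr pair; rewrite /s /c; ring.
- by congr pair; ring.
- have -> : pi - beta - thL = pi - (beta + thL) by rewrite opprD addrA.
  rewrite cosB sinB cospi sinpi cosD sinD cos_beta sin_beta.
  by congr pair; ring.
- have -> : pi - beta - thL = pi - (beta + thL) by rewrite opprD addrA.
  rewrite cosB sinB cospi sinpi cosD sinD cos_beta sin_beta.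
  by congr pair; ring.
- by rewrite cosD sinD cos_beta sin_beta; congr pair; ring.
- by rewrite cosD sinD cos_beta sin_beta; congr pair; ring.
- by congr pair; ring.
- by congr pair; rewrite /s /c; ring.
- by congr pair; rewrite /s /c; ring.
Qed.

Lemma scaled_directionE l : weighted l ->
  scaled_direction (cos thR / s) (sin thR / c) (cos thL / s) (sin thL / c) l =
  (par_S * (trig_direction l).1, par_S * (trig_direction l).2).
Proof.
have s0 : s != 0 by rewrite gt_eqF ?par_s_gt0.
have c0 : c != 0 by rewrite gt_eqF ?par_c_gt0.
have SE : 766 ^+ 2 + 197 ^+ 2 = par_S :> R by [].
case: l => // _; rewrite /scaled_direction ?SE -?par_sc -?par_ss -?par_cc /=;
  congr pair; try by field; rewrite ?s0 ?c0.
all: try by rewrite ?mulr0 // mulrN1.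
Qed.

Local Notation dir := (direction thR thL tR tL).
Local Notation wt := (weight (sin thR / c) (sin thL / c)).

Lemma scaled_resultantE (ls : seq label) :
  resultant (scaled_direction (cos thR / s) (sin thR / c)
                              (cos thL / s) (sin thL / c)) wt ls =
  (par_S * (resultant dir wt ls).1, par_S * (resultant dir wt ls).2).
Proof.
rewrite /resultant /= !mulr_sumr; congr pair; apply: eq_bigr => l _;
  (case: (boolP (weighted l)) => [wl|wl];
    first by rewrite directionE // scaled_directionE //= mulrCA);
  by rewrite unweighted // !mul0r mulr0.
Qed.

Lemma unit_disk (ls : seq label) :
  in_disk (766 ^+ 2 + 197 ^+ 2)
    (resultant (scaled_direction (cos thR / s) (sin thR / c)
                                 (cos thL / s) (sin thL / c)) wt ls) ->
  in_disk 1 (resultant dir wt ls).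
Proof.
rewrite scaled_resultantE /in_disk /= !exprMn -mulrDr -[X in _ <= X]mulr1.
by rewrite ler_pM2l ?expr1n // exprn_gt0 // par_S_gt0.
Qed.

Lemma direction_resultant (ord : seq label) :
  perm_eq ord fan -> resultant dir wt ord = (0, 0).
Proof.
move=> ord_perm; rewrite (resultant_perm _ _ ord_perm).
have S0 : (par_S : R) != 0 by rewrite gt_eqF ?par_S_gt0.
have := scaled_resultantE fan; rewrite resultant_fan.
move=> -[/esym/eqP + /esym/eqP].
rewrite !mulf_eq0 (negbTE S0) /= => /eqP e1 /eqP e2.
by rewrite /resultant e1 e2.
Qed.

(** Turning the normals [(par_s, par_c)], [(- par_s, par_c)] and
    [(0, - 2 * par_c)] of the triangle by the rotation with cosine [u] and sine
    [v] gives the four triples of directions, when [(u, v)] is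
    [(- par_c, - par_s)], [(- par_c, par_s)], [(sin thR, - cos thR)] and
    [(sin thL, cos thL)] respectively. *)
Lemma support_total (g0 : seq plane) (f : plane -> plane)
    (ct : label -> plane) :
  escape g0 -> rigid_coordinates f ->
  (forall l x, x \in map f g0 -> dot x (dir l) <= dot (ct l) (dir l)) ->
  (ct LF).2 = 0 -> (ct LT).2 = 0 ->
  dot (ct LU) (dir LU) = dot (ct LV) (dir LU) ->
  dot (ct LW) (dir LW) = dot (ct LX) (dir LW) ->
  R_const <= \sum_(l <- fan) wt l * dot (ct l) (dir l).
Proof.
move=> esc f_rigid ct_max F0 T0 UV WX.
pose H l := dot (ct l) (dir l).
have escape_triple (u v : R) l1 l2 l3 : u ^+ 2 + v ^+ 2 = 1 ->
    weighted l1 && weighted l2 && weighted l3 ->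
    trig_direction l1 = (s * u - c * v, s * v + c * u) ->
    trig_direction l2 = (- (s * u) - c * v, - (s * v) + c * u) ->
    trig_direction l3 = (2 * c * v, - (2 * c * u)) ->
    2 * s * c <= H l1 + H l2 + H l3.
  move=> uv /andP[/andP[w1 w2] w3] e1 e2 e3.
  apply: (escape_support esc f_rigid uv) => x xg.
  by rewrite -e1 -e2 -e3 -!directionE //; split; exact: ct_max.
have sc1 := @par_s2Dc2 R.
have cs_R := cos2Dsin2 thR; have cs_L := cos2Dsin2 thL.
have triple1 : 2 * s * c <= H LF + H LZ1 + H LQ3.
  apply: (escape_triple (- c) (- s)); rewrite //= ?sqrrN 1?addrC //;
    by congr pair; nra.
have triple2 : 2 * s * c <= H LZ2 + H LT + H LP2.
  apply: (escape_triple (- c) s); rewrite //= ?sqrrN 1?addrC //;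
    by congr pair; nra.
have tripleR : 2 * s * c <= H LBR + H LU + H LAR.
  apply: (escape_triple (sin thR) (- cos thR));
    rewrite //= ?sqrrN 1?addrC //; by congr pair; ring.
have tripleL : 2 * s * c <= H LW + H LBL + H LAL.
  apply: (escape_triple (sin thL) (cos thL)); rewrite //= 1?addrC //;
    by congr pair; ring.
have HF : H LF = 0 by rewrite /H /dot /= F0; ring.
have HT : H LT = 0 by rewrite /H /dot /= T0; ring.
have HV : H LV = H LU by rewrite /H UV.
have HX : H LX = H LW by rewrite /H WX.
have rho_ge : R_const <= 2 * (anchor_weight + delimiter_weight) * (2 * s * c).
  have S0 := @par_S_gt0 R; rewrite -(ler_pM2l S0).
  have -> : par_S * (2 * (anchor_weight + delimiter_weight) * (2 * s * c)) =
    2 * (anchor_weight + delimiter_weight) * 2 * (par_S * (s * c)) by ring.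
  rewrite par_sc /par_S /par_p /par_q /R_const.
  rewrite /anchor_weight /delimiter_weight; lra.
apply: (le_trans rho_ge); rewrite !big_cons big_nil -!/(H _) /= HF HT HV HX.
rewrite /anchor_weight /delimiter_weight; lra.
Qed.

End Assembly.

Lemma D_lt_R (R : realType) : (D_const : R) < R_const.
Proof.
have d0 : 0 < 84 * 10 ^+ 9 + 861 * 10 ^+ 6 + 20 * 10 ^+ 3 + 75 :> R by lra.
rewrite /D_const ltr_pdivrMr // /R_const; lra.
Qed.

Lemma sorted_index_lt (T : eqType) (pos : T -> nat) (s : seq T) a b :
  sorted (fun x y => pos x <= pos y)%N s -> a \in s -> b \in s ->
  (pos a < pos b)%N -> (index a s < index b s)%N.
Proof.
move=> s_sorted sa sb ab; rewrite ltnNge; apply/negP => ba.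
have trans : transitive (fun x y => pos x <= pos y)%N.
  by move=> x y z; exact: leq_trans.
have refl : reflexive (fun x y => pos x <= pos y)%N.
  by move=> x; exact: leqnn.
by have := sorted_leq_index trans refl s_sorted _ _ sb sa ba; rewrite leqNgt ab.
Qed.

Theorem theorem6p2 (R : realType)
  (* an intrinsic path gamma0, and gamma = its copy in the chosen coordinates *)
  (gamma0 gamma w : seq (R * R)) (f : R * R -> R * R) (h : R)
  (ct : label -> R * R) (thR thL tR tL : R) (ord : seq label)
  (gamma_standard : standard gamma0)
  (gamma_nonconvex : ~ convex_path gamma0)
  (gamma_minimizer : escape_minimizer gamma0)
  (f_rigid : rigid_coordinates f)
  (gammaE : gamma = [seq f x | x <- gamma0])
  (FT_selected : selected_gap gamma (ct LF) (ct LM) (ct LT) h)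
  (contacts : marked_contacts gamma w thR thL tR tL ct)
  (UV_delimiter : right_delimiter_gap gamma w thR tR ct)
  (WX_delimiter : left_delimiter_gap gamma w thL tL ct)
  (near_anchors_fail :
     [/\ before gamma (ct LZ2) (ct LF), before gamma (ct LF) (ct LM),
         before gamma (ct LM) (ct LT) & before gamma (ct LT) (ct LZ1)])
  (UV_order :
     [/\ before gamma (ct LF) (ct LU), before gamma (ct LU) (ct LT) &
         before gamma (ct LT) (ct LV)])
  (WX_order :
     [/\ before gamma (ct LW) (ct LF), before gamma (ct LF) (ct LX) &
         before gamma (ct LX) (ct LT)])
  (tR_range : - tstar <= tR <= tstar)
  (tL_range : - tstar <= tL <= tstar)
  (ord_compatible : compatible_deque_order gamma ct ord) :
  R_const <= plength gamma0 /\ (D_const : R) < R_const.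
Proof.
split; last exact: D_lt_R.
have gamma_escape : escape gamma0 by case: gamma_minimizer => N [].
rewrite -(plength_rigid gamma0 f_rigid) -gammaE.
have [_ ct_contact _] := contacts.
have [_ [[F0 T0 _ _] _]] := FT_selected.
have [_ thR_range tRE] := UV_delimiter; have [_ thL_range tLE] := WX_delimiter.
pose d := direction thR thL tR tL.
pose wt := weight (sin thR / par_c) (sin thL / par_c).
have ct_gamma l : ct l \in gamma.
  exact: extreme_point_vertex (ct_contact l).1.
have ct_max l x : x \in gamma -> dot x (d l) <= dot (ct l) (d l).
  by move=> xg; apply: (ct_contact l).2; apply: sub_hull; left.
have [ord_perm ord_sorted ord_arcs] := ord_compatible.
have ord_all l : l \in ord by rewrite (perm_mem ord_perm); case: l.
have pos_lt a b : before gamma (ct a) (ct b) -> (index a ord < index b ord)%N.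
  exact: (sorted_index_lt ord_sorted).
have arcR := delimiter_arc_point thR_range.
have arcL := delimiter_arc_point thL_range.
case: near_anchors_fail => _ FM MT _.
case: UV_order => _ UT TV; case: WX_order => WF FX XT.
have total : R_const <= \sum_(l <- ord) wt l * dot (ct l) (d l).
  rewrite (perm_big _ ord_perm) /=.
  apply: (support_total thR_range thL_range tRE tLE gamma_escape f_rigid) => //.
  - by rewrite -gammaE.
  - by apply: le_anti; rewrite !(ct_max LU, ct_max LV).
  - by apply: le_anti; rewrite !(ct_max LW, ct_max LX).
apply: (le_trans total); apply: weighted_contacts_le_plength => //.
  exact: direction_resultant.
move=> k; apply: unit_disk => //.
apply: suffix_disk => //; first by rewrite drop_uniq // (perm_uniq ord_perm).
by apply: suffix_shape => //; exact: pos_lt.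
Qed.
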